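(* Let $S=\{0,b\}\subseteq\mathbb{Z}_n$ where $\gcd(b,n)=1$. Then \[p_{n}(S) = \begin{cases} 1 & \text{if } |\langle b\rangle| \text{ is odd},\\ 2 & \text{if } |\langle b\rangle| \text{ is even}. \end{cases}\]
   Context: $\mathbb{Z}_n$ is the additive group of integers modulo $n$, with elements identified with $0,1,\dots,n-1$ when speaking of gcds; $\langle b\rangle$ is the subgroup generated by $b$. For $S\subseteq \mathbb{Z}_n$ and $x\in\mathbb{Z}_n$, the set $x+S=\{x+s : s\in S\}$ is a translate of $S$. A coloring of the elements of $\mathbb{Z}_n$ with $k$ colors is $S$-polychromatic if every translate of $S$ contains an element of each of the $k$ colors. The polychromatic number $p_n(S)$ is the largest $k$ such that there is an $S$-polychromatic coloring of $\mathbb{Z}_n$ with $k$ colors. *)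

(* Defs.v *)
From HB Require Import structures.
From mathcomp Require Import all_boot all_order all_algebra all_fingroup.

Set Implicit Arguments.
Unset Strict Implicit.
Unset Printing Implicit Defensive.

Import GRing.Theory.
Local Open Scope ring_scope.

(* The integers modulo n.+1 are represented by 'I_n.+1, with its canonical    *)
(* additive group structure, rather than by 'Z_n.+1, so that the trivial      *)
(* group is covered: 'Z_1 has two elements.                                   *)

Section Polychromatic.

Variable n : nat.
Implicit Types (S : {set 'I_n.+1}) (x : 'I_n.+1) (k : nat).

Definition translate x S : {set 'I_n.+1} := [set x + s | s in S].

Definition polychromatic S k (c : {ffun 'I_n.+1 -> 'I_k}) : bool :=
  [forall x : 'I_n.+1, forall i : 'I_k, exists y in translate x S, c y == i].

Definition polychromatic_colorable S k : bool :=
  [exists c : {ffun 'I_n.+1 -> 'I_k}, polychromatic S c].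

(* The range of the maximum is no restriction: see polychromatic_numberP. If  *)
(* S is empty then no k qualifies and the value is 0.                         *)
Definition polychromatic_number S : nat :=
  \max_(k < n.+2 | polychromatic_colorable S k) k.

Lemma polychromaticP S k (c : {ffun 'I_n.+1 -> 'I_k}) :
  reflect (forall x (i : 'I_k), exists2 y, y \in translate x S & c y = i)
          (polychromatic S c).
Proof.
apply: (iffP forallP) => [h x i | h x].
  by have /forallP/(_ i)/exists_inP[y yS /eqP cy] := h x; exists y.
apply/forallP => i; have [y yS cy] := h x i.
by apply/exists_inP; exists y => //; apply/eqP.
Qed.

Lemma polychromatic_colorable_leq S k :
  polychromatic_colorable S k -> (k <= n.+1)%N.
Proof.
case/existsP=> c /polychromaticP h.
have sub : [set: 'I_k] \subset c @: [set: 'I_n.+1].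
  by apply/subsetP => i _; have [y _ <-] := h 0 i; apply: imset_f.
have := leq_trans (subset_leq_card sub) (leq_imset_card _ _).
by rewrite !cardsT !card_ord.
Qed.

Lemma polychromatic_colorable1 S : S != set0 -> polychromatic_colorable S 1.
Proof.
case/set0Pn=> s sS; apply/existsP; exists [ffun=> ord0].
apply/polychromaticP => x i; exists (x + s); first exact: imset_f.
by rewrite ffunE [i]ord1.
Qed.

Lemma polychromatic_numberP S k : S != set0 ->
  polychromatic_number S = k <->
  polychromatic_colorable S k /\
  (forall j, polychromatic_colorable S j -> (j <= k)%N).
Proof.
move=> S0; have le_max j : polychromatic_colorable S j ->
    (j <= polychromatic_number S)%N.
  move=> hj; have ltj : (j < n.+2)%N by exact: polychromatic_colorable_leq hj.
  exact: (leq_bigmax_cond (F := fun k : 'I_n.+2 => nat_of_ord k) (Ordinal ltj)).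
have hmax : polychromatic_colorable S (polychromatic_number S).
  have h1 : (0 < #|[pred k : 'I_n.+2 | polychromatic_colorable S k]|)%N.
    apply/card_gt0P; exists (Ordinal (isT : 1 < n.+2)%N).
    exact: polychromatic_colorable1.
  have [i hi e] := eq_bigmax_cond (fun k : 'I_n.+2 => nat_of_ord k) h1.
  by rewrite /polychromatic_number e.
split=> [<- // | [hk le_k]].
by apply/eqP; rewrite eqn_leq le_k //= le_max.
Qed.

End Polychromatic.

(* Main.v *)
Require Import Defs.
From mathcomp Require Import all_boot all_order all_algebra all_fingroup.

(** A translate of [S] must show [k] colors on at most [#|S|] elements, so a
    two-element [S] admits at most two colors, and one color always works.
    Everything thus rests on whether two colors are possible for [{0, b}], that
    is, on whether some boolean coloring flips at every step [x |-> x + b]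
    ([colorable2P]).
    - Walking from [0] around the subgroup generated by [b] flips the color
      [#[b]] times and comes back to [0], so [#[b]] is even
      ([alternating_even_order]).
    - Conversely, if [#[b]] is even then so is the order [n + 1] of the whole
      group, by Lagrange.  Hence [b], being coprime to [n + 1], is odd, and
      reduction modulo [n + 1] preserves parity, so that parity is itself an
      alternating coloring ([odd_alternating]). *)

Import GRing.Theory.
Local Open Scope ring_scope.

(** Each translate of [S] maps onto the set of all colors. *)
Lemma colorable_leq_card n (S : {set 'I_n.+1}) k :
  polychromatic_colorable S k -> (k <= #|S|)%N.
Proof.
case/existsP=> c /polychromaticP h.
have sub : [set: 'I_k] \subset c @: translate 0 S.
  by apply/subsetP => i _; have [y yS <-] := h 0 i; apply: imset_f.
have := leq_trans (subset_leq_card sub) (leq_imset_card _ _).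
rewrite cardsT card_ord => /leq_trans; apply; exact: leq_imset_card.
Qed.

Lemma translate_pair n (b x : 'I_n.+1) :
  translate x [set 0; b] = [set x; x + b].
Proof. by rewrite /translate imsetU1 imset_set1 addr0. Qed.

(** Two points show both of two colors exactly when their colors differ; with
    booleans for colors, differing is negation. *)
Lemma colorable2P n (b : 'I_n.+1) :
  polychromatic_colorable [set 0; b] 2 <->
  exists f : 'I_n.+1 -> bool, forall x, f (x + b) = ~~ f x.
Proof.
split=> [/existsP[c /polychromaticP h] | [f hf]].
  exists (fun x => c x == 0) => x.
  have [y] := h x 0; have [z] := h x 1.
  (* If one point carried both colors 0 and 1, these would be equal. *)
  rewrite translate_pair !inE => /orP[]/eqP-> cz /orP[]/eqP-> cy;
    by rewrite ?cy ?cz //; move: cz; rewrite cy.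
apply/existsP; exists [ffun x => if f x then 0 else 1].
apply/polychromaticP => x i; rewrite translate_pair.
have [fx|fx] := boolP (f x == (i == 0)); [exists x | exists (x + b)];
  rewrite ?inE ?eqxx ?orbT // ffunE ?hf; move: fx;
  by case: (f x); case: i => [[|[|//]] lti] //= _; apply: val_inj.
Qed.

(** In the additive group of residues [(b ^+ j)%g] is the [j]-fold sum of [b], so
    [#[b]] successive flips bring the color of [0] back to itself. *)
Lemma alternating_even_order n (b : 'I_n.+1) (f : 'I_n.+1 -> bool) :
  (forall x, f (x + b) = ~~ f x) -> ~~ odd #[b]%g.
Proof.
move=> hf.
have walk j : f (b ^+ j)%g = odd j (+) f 0.
  by elim: j => [|j IHj]; rewrite ?expg0 // expgSr hf IHj addNb.
by have := walk #[b]%g; rewrite expg_order; case: odd => //; case: (f 0).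
Qed.

(** Adding an odd number flips parity, and wrapping around subtracts the even
    number [n.+1]. *)
Lemma odd_alternating n (b x : 'I_n.+1) :
  ~~ odd n.+1 -> odd b -> odd (x + b : 'I_n.+1)%R = ~~ odd x.
Proof.
move=> /negbTE evN ob.
have -> : odd (x + b : 'I_n.+1)%R = odd ((x + b)%N %% n.+1) by [].
by rewrite odd_mod // oddD ob addbT.
Qed.

Theorem proposition3p1 (n : nat) (b : 'I_n.+1) (hb : gcdn b n.+1 = 1%N) :
  polychromatic_number [set 0%R; b] = if odd #|<[b]>%g| then 1%N else 2%N.
Proof.
have S0 : [set 0; b] != set0 by apply/set0Pn; exists 0; rewrite !inE eqxx.
have le2 j : polychromatic_colorable [set 0; b] j -> (j <= 2)%N.
  by move=> /colorable_leq_card/leq_trans; apply; rewrite cards2; case: (_ != _).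
apply/(polychromatic_numberP _ S0); rewrite -/(#[b]%g); case: ifPn => ob.
  split=> [|j hj]; first exact: polychromatic_colorable1.
  have := le2 _ hj; rewrite leq_eqVlt ltnS => /orP[/eqP j2|//].
  move: hj; rewrite j2 => /colorable2P[f /alternating_even_order].
  by rewrite ob.
split=> //; apply/colorable2P.
have evN : ~~ odd n.+1.
  have := cardSg (subsetT <[b]>%G); rewrite cardsT card_ord.
  by move=> dvd_bN; apply: contra ob; apply: dvdn_odd.
exists (fun x => odd x) => x; apply: odd_alternating => //.
apply/negPn/negP => eb.
(* An even [b] would share the factor 2 with [n.+1]. *)
have : (2 %| gcdn b n.+1)%N by rewrite dvdn_gcd !dvdn2 eb evN.
by rewrite hb.
Qed.
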